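(* There exists $c>0$ such that, for all sufficiently large $n$, there are at least $2^{cn^2}$ pairwise non-isomorphic Ramsey saturated graphs on $n$ vertices.
   Context: The Ramsey number $r(G)$ of a graph $G$ is the smallest natural number $N$ such that every two-coloring of the edges of $K_N$ contains a monochromatic copy of $G$. A graph $G$ on $n$ vertices (viewed as a spanning subgraph of $K_n$) is Ramsey saturated if $r(G+e)>r(G)$ for every edge $e\in E(K_n)\setminus E(G)$, where $G+e$ is the graph obtained from $G$ by adding the edge $e$. *)

(* Defs.v *)
From mathcomp Require Import all_boot perm.
Set Implicit Arguments.
Unset Strict Implicit.
Unset Printing Implicit Defensive.

(* Edges of K_n: two-element sets of vertices.  A simple graph on the vertex
   set 'I_n is then an arbitrary set of edges of K_n; G + e is [e |: G]. *)
Definition edge (n : nat) := {e : {set 'I_n} | #|e| == 2}.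
Definition sgraph (n : nat) := {set edge n}.

Definition edge_sets (n : nat) (G : sgraph n) : {set {set 'I_n}} :=
  [set val e | e in G].

(* Not-necessarily-induced copy: an injection mapping edges to edges. *)
Definition has_copy (n N : nat) (G : sgraph n) (H : sgraph N) : bool :=
  [exists f : {ffun 'I_n -> 'I_N},
     injectiveb f && [forall E in edge_sets G, f @: E \in edge_sets H]].

Definition color_class (N : nat) (c : {ffun edge N -> bool}) (b : bool)
  : sgraph N := [set e | c e == b].

Definition arrows (n : nat) (G : sgraph n) (N : nat) : bool :=
  [forall c : {ffun edge N -> bool},
     [exists b : bool, has_copy G (color_class c b)]].

Lemma mono_subset (T : finType) (col : rel T) (a b : nat) (A : {set T}) :
  symmetric col -> 2 ^ (a + b) <= #|A| ->
  exists c : bool, exists S : {set T},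
    [/\ S \subset A, (if c then a else b) <= #|S|
      & {in S &, forall x y, x != y -> col x y = c}].
Proof.
move=> sym.
have [k] := ubnP (a + b); elim: k a b A => // k IH [|a] [|b] A.
- by exists true, set0; rewrite sub0set; split=> // x y; rewrite inE.
- by exists true, set0; rewrite sub0set; split=> // x y; rewrite inE.
- by exists false, set0; rewrite sub0set; split=> // x y; rewrite inE.
move=> ltk leA.
have /card_gt0P[x xA] : 0 < #|A| by rewrite (leq_trans _ leA) // expn_gt0.
pose B d := [set y in A :\ x | col x y == d].
have subB d : B d \subset A by apply/subsetP=> y; rewrite !inE => /andP[/andP[]].
have cardB : #|A| = (#|B true| + #|B false|).+1.
  rewrite (cardsD1 x A) xA add1n; congr _.+1.
  rewrite -(cardsID [set y | col x y] (A :\ x)).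
  by congr (_ + _); apply: eq_card => y; rewrite !inE; case: (col x y);
    rewrite ?andbT ?andbF.
have extend d (S : {set T}) : S \subset B d ->
    {in S &, forall y z, y != z -> col y z = d} ->
    [/\ x |: S \subset A, #|S| < #|x |: S|
      & {in x |: S &, forall y z, y != z -> col y z = d}].
  move=> /subsetP SB colS; have xS : x \notin S.
    by apply/negP=> /SB; rewrite !inE eqxx.
  split; first by rewrite subUset sub1set xA; apply/subsetP=> y /SB /(subsetP (subB d)).
    by rewrite cardsU1 xS.
  move=> y z /setU1P[->|yS] /setU1P[->|zS]; first by rewrite eqxx.
  - by move: (SB _ zS); rewrite !inE => /andP[_ /eqP].
  - by move: (SB _ yS); rewrite !inE sym => /andP[_ /eqP].
  - exact: colS.
have : (2 ^ (a + b.+1) <= #|B true|) || (2 ^ (a.+1 + b) <= #|B false|).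
  rewrite addSnnS; case: leqP => //= ltB; move: leA.
  rewrite cardB addSn expnS mul2n -addnn -addSn => le2.
  by rewrite -(leq_add2l (2 ^ (a + b.+1))) (leq_trans le2) // leq_add2r.
case/orP => leB.
  have [|c [S [SB cS colS]]] := IH _ _ _ _ leB; first by rewrite -ltnS.
  case: c cS colS => cS colS.
    have [? lt ?] := extend _ _ SB colS.
    by exists true, (x |: S); split=> //; apply: leq_trans _ lt.
  by exists false, S; split=> //; apply: subset_trans SB _.
have [|c [S [SB cS colS]]] := IH _ _ _ _ leB; first by rewrite -ltnS -addnS.
case: c cS colS => cS colS.
  by exists true, S; split=> //; apply: subset_trans SB _.
have [? lt ?] := extend _ _ SB colS.
by exists false, (x |: S); split=> //; apply: leq_trans _ lt.
Qed.

Theorem ramsey_exists (n : nat) (G : sgraph n) : exists N, arrows G N.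
Proof.
exists (2 ^ (n + n)); apply/forallP=> c; set N := 2 ^ (n + n) in c *.
pose col (x y : 'I_N) := [exists e, (val e == [set x; y]) && c e].
have sym : symmetric col by move=> x y; rewrite /col setUC.
have [|b [S [_ leS colS]]] := @mono_subset _ col n n [set: 'I_N] sym.
  by rewrite cardsT card_ord.
apply/existsP; exists b; apply/existsP.
have {}leS : n <= #|S| by case: b leS {colS}.
pose f := [ffun i : 'I_n => enum_val (widen_ord leS i)].
have injf : injective f.
  by move=> i j; rewrite !ffunE => /enum_val_inj /(congr1 val) /= /val_inj.
exists f; apply/andP; split; first exact/injectiveP.
apply/forall_inP=> _ /imsetP[e _ ->].
have card2 : #|f @: val e| == 2 by rewrite card_imset // (valP e).
pose e' : edge N := Sub (f @: val e) card2.
apply/imsetP; exists e'; rewrite ?inE //.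
have /cards2P[x [y [neq_xy Exy]]] : #|val e| == 2 := valP e.
have fS i : f i \in S by rewrite ffunE enum_valP.
rewrite -(colS _ _ (fS x) (fS y)) ?(inj_eq injf) //.
apply/eqP; have Ee' : val e' = [set f x; f y].
  by rewrite /= Exy imsetU1 imset_set1.
apply/idP/existsP => [ce'|[e2 /andP[/eqP Ee2]]].
  by exists e'; rewrite Ee' eqxx.
by rewrite (_ : e2 = e') //; apply: val_inj; rewrite Ee2 Ee'.
Qed.

Definition ramsey (n : nat) (G : sgraph n) : nat := ex_minn (ramsey_exists G).

Definition ramsey_saturated (n : nat) (G : sgraph n) : Prop :=
  forall e : edge n, e \notin G -> ramsey G < ramsey (e |: G).

Definition isomorphic (n : nat) (G H : sgraph n) : Prop :=
  exists s : 'S_n, edge_sets H = [set s @: E | E : {set 'I_n} in edge_sets G].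

(* Main.v *)
(* A maximal element of {G | r(G) <= N} is Ramsey saturated, and every graph
   with r <= N lies below one.  Take N = 2^(5d) with d a small constant
   times n.  Counting colourings, a graph with r <= N has at most 5dn + 1 edges.
   On the other hand, split off a set A of 32d vertices into d groups of 32, and
   let each remaining vertex choose one neighbour in every group: by dependent
   random choice all these 32^(dm) graphs, m = n - 32d, have r <= N.  A graph
   with few edges contains few of them, so that 2^(c n^2) maximal elements are
   needed to cover them all, and passing to isomorphism classes costs only a
   factor n!. *)
Require Import Defs.
From mathcomp Require Import all_boot all_order all_algebra all_fingroup.
From mathcomp Require Import reals exp.
From mathcomp Require Import zify.

Set Implicit Arguments.
Unset Strict Implicit.
Unset Printing Implicit Defensive.

(** * The edge bound, by counting colourings *)

Lemma leq_card_bigcup (I T : finType) (P : pred I) (F : I -> {set T}) :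
  #|\bigcup_(i | P i) F i| <= \sum_(i | P i) #|F i|.
Proof.
apply: (big_ind2 (fun (A : {set T}) k => #|A| <= k)) => // [|A k B l lA lB].
  by rewrite cards0.
exact: leq_trans (leq_card_setU A B) (leq_add lA lB).
Qed.

Lemma mem_edge_sets n (G : sgraph n) (e : edge n) :
  (val e \in edge_sets G) = (e \in G).
Proof. by rewrite mem_imset //; apply: val_inj. Qed.

Lemma card_colorings (T : finType) (E : {set T}) (b : bool) :
  #|[set c : {ffun T -> bool} | [forall e in E, c e == b]]| * 2 ^ #|E| = 2 ^ #|T|.
Proof.
pose F e := if e \in E then pred1 b else predT.
have -> : #|[set c : {ffun T -> bool} | [forall e in E, c e == b]]| = #|family F|.
  apply: eq_card => c; rewrite inE; apply/forall_inP/familyP => Fc e.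
    by rewrite /F; case: ifP => // /Fc.
  by move=> eE; have := Fc e; rewrite /F eE.
rewrite card_family foldrE big_map big_enum /= (bigID [in E]) /=.
rewrite big1 => [|e eE]; last by rewrite /F eE card1.
rewrite (eq_bigr (fun=> 2)) => [|e eE]; last by rewrite /F (negPf eE) card_bool.
rewrite mul1n prod_nat_const -expnD -(cardC E); congr (_ ^ _).
by rewrite addnC.
Qed.

(** A union bound over the [2 * N ^ n] pairs of a colour and a map: an injective map sends the edges
    of [G] to [#|G|] distinct edges of K_N, which all receive the given colour in a fraction
    2^(-|G|) of the colourings. *)
Lemma arrows_card n (G : sgraph n) N : arrows G N -> 2 ^ #|G| <= 2 * N ^ n.
Proof.
move=> arr.
pose C (bf : bool * {ffun 'I_n -> 'I_N}) :=
  [set c : {ffun edge N -> bool} |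
    [forall e in edge_sets G, bf.2 @: e \in edge_sets (color_class c bf.1)]
    && injectiveb bf.2].
have cardC bf : #|C bf| * 2 ^ #|G| <= 2 ^ #|{: edge N}|.
  have [/injectiveP inj|ninj] := boolP (injectiveb bf.2); last first.
    rewrite (_ : C bf = set0) ?cards0 //; apply/setP => c.
    by rewrite !inE (negPf ninj) andbF.
  have card2 (e : edge n) : #|bf.2 @: val e| == 2 by rewrite card_imset // (valP e).
  pose fe (e : edge n) : edge N := Sub (bf.2 @: val e) (card2 e).
  have feI : injective fe.
    by move=> e e' /(congr1 val) /= /(imset_inj inj) /val_inj.
  rewrite -(card_imset _ feI) -(card_colorings (fe @: G) bf.1) leq_mul2r.
  apply/orP; right; apply/subset_leq_card/subsetP => c; rewrite !inE.
  case/andP=> /forall_inP cG _; apply/forall_inP => _ /imsetP[e eG ->].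
  have := cG (val e); rewrite mem_edge_sets => /(_ eG).
  by rewrite -[_ @: _]/(val (fe e)) mem_edge_sets inE.
have : 2 ^ #|{: edge N}| <= \sum_bf #|C bf|.
  have <- : #|{ffun edge N -> bool}| = 2 ^ #|{: edge N}| by rewrite card_ffun card_bool.
  apply: leq_trans (leq_card_bigcup predT C).
  apply/subset_leq_card/subsetP => c _; apply/bigcupP.
  have /existsP[b /existsP[f /andP[injf cG]]] := forallP arr c.
  by exists (b, f); rewrite ?inE ?cG.
move/(leq_mul (leqnn (2 ^ #|G|))); rewrite mulnC big_distrr /= => le.
rewrite -(leq_pmul2l (_ : 0 < 2 ^ #|{: edge N}|)) ?expn_gt0 //.
apply: leq_trans le _.
apply: (@leq_trans (\sum_(bf : bool * {ffun 'I_n -> 'I_N}) 2 ^ #|{: edge N}|)).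
  by apply: leq_sum => bf _; rewrite mulnC.
by rewrite sum_nat_const card_prod card_bool card_ffun !card_ord mulnC.
Qed.

(** * Passing to isomorphism classes *)

Lemma isomorphic_sym n (G H : sgraph n) : isomorphic G H -> isomorphic H G.
Proof.
case=> s eH; exists (s^-1)%g; rewrite eH -imset_comp -[LHS]imset_id.
apply: eq_imset => E /=; rewrite -imset_comp -[LHS]imset_id.
by apply: eq_imset => x /=; rewrite permK.
Qed.

(** [S] is a maximal pairwise non-isomorphic subset of [M]. By maximality the isomorphism classes of
    its members cover [M], and each class, being an orbit of ['S_n], has at most n! members. *)
Lemma nonisomorphic_family n (M : {set sgraph n}) :
  exists S : {set sgraph n}, [/\ S \subset M,
    {in S &, forall G H, G != H -> ~ isomorphic G H} & #|M| <= #|S| * n`!].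
Proof.
pose iso (G H : sgraph n) :=
  [exists s : 'S_n, edge_sets H == [set s @: E | E : {set 'I_n} in edge_sets G]].
have isoP G H : reflect (isomorphic G H) (iso G H).
  by apply: (iffP existsP) => -[s] /eqP; exists s => //; apply/eqP.
pose P (S : {set sgraph n}) := (S \subset M) &&
  [forall G in S, forall H in S, (G != H) ==> ~~ iso G H].
have P0 : P set0 by rewrite /P sub0set; apply/forall_inP => G; rewrite inE.
have [S /maxsetP[/andP[SM /forall_inP indep] maxS] _] := maxset_exists P0.
exists S; split=> // [G H GS HS GH /isoP isoGH|].
  by move/forall_inP: (indep G GS) => /(_ H HS) /implyP/(_ GH)/negP.
have cover : M \subset \bigcup_(G in S) [set H | iso G H].
  apply/subsetP => H HM; apply/bigcupP; apply/exists_inP/contraT => /exists_inPn noG.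
  have noGH G : G \in S -> ~~ iso G H /\ ~~ iso H G.
    move=> /noG; rewrite inE => nGH; split=> //.
    by apply: contra nGH => /isoP/isomorphic_sym/isoP.
  have /negP[] : H \notin S.
    apply/negP => /noGH[/negP[]]; apply/isoP; exists 1%g.
    rewrite -[LHS]imset_id; apply: eq_imset => E; rewrite -[LHS]imset_id.
    by apply: eq_imset => x; rewrite perm1.
  rewrite -(maxS (H |: S)) ?setU11 ?subsetUr //.
  rewrite /P subUset sub1set HM SM; apply/forall_inP => G1 /setU1P[->|G1S];
    apply/forall_inP => G2 /setU1P[->|G2S]; apply/implyP => //.
  - by rewrite eqxx.
  - by have [] := noGH _ G2S.
  - by have [] := noGH _ G1S.
  - by apply/implyP; move/forall_inP: (indep _ G1S) => /(_ _ G2S).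
apply: leq_trans (subset_leq_card cover) _.
apply: leq_trans (leq_card_bigcup _ _) _.
rewrite -sum_nat_const; apply: leq_sum => G _.
rewrite -card_Sn -[#|'S_n|]cardsT.
apply: leq_trans (leq_imset_card (fun s : 'S_n =>
  [set e : edge n | val e \in [set s @: E | E : {set 'I_n} in edge_sets G]]) _).
apply/subset_leq_card/subsetP => H; rewrite inE => /isoP[s eH].
apply/imsetP; exists s => //; apply/setP => e.
by rewrite inE -eH mem_edge_sets.
Qed.

(** * Dependent random choice and the family of selection graphs *)

Lemma leq_expl (m n e : nat) : m <= n -> m ^ e <= n ^ e.
Proof. by case: e => // e mn; rewrite leq_exp2r. Qed.

(** Average over samples [s] of [t] vertices. If every sample fails, then each [U s] has fewer than
    [a] elements or contains a bad tuple [h], one with fewer than [n] common neighbours; this makes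
    the sum of all [#|U s|] too small. *)
Lemma dependent_random_choice (T : finType) (r : rel T) (X : {set T})
    (D a n d t : nat) :
  {in X, forall x, D <= #|[set y | r x y]|} ->
  #|T| ^ d * n ^ t * #|T| + #|T| ^ t * a < #|X| * D ^ t ->
  exists U : {set T}, a <= #|U| /\
    forall h : {ffun 'I_d -> T}, (forall j, h j \in U) ->
      n <= #|[set y | [forall j, r (h j) y]]|.
Proof.
move=> degX ltX.
pose U (s : {ffun 'I_t -> T}) := [set x | [forall i, r x (s i)]].
pose CN (h : {ffun 'I_d -> T}) := [set y | [forall j, r (h j) y]].
have [/existsP[s /andP[aU /forallP okU]]|/existsPn noU] := boolP
  [exists s, (a <= #|U s|) &&
    [forall h : {ffun 'I_d -> T}, [forall j, h j \in U s] ==> (n <= #|CN h|)]].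
  exists (U s); split=> // h hU.
  by have /implyP := okU h; apply; apply/forallP.
(* Double counting: [x] lies in [U s] exactly when all entries of [s] are neighbours of [x], so [x]
   is counted deg(x)^t times. *)
have lower : #|X| * D ^ t <= \sum_s #|U s|.
  have -> : \sum_s #|U s| = \sum_x #|[set y | r x y]| ^ t.
    under eq_bigr do rewrite -sum1_card big_mkcond.
    rewrite exchange_big; apply: eq_bigr => x _ /=.
    rewrite -big_mkcond sum1_card.
    have := @card_ffun_on 'I_t T (mem [set y | r x y]); rewrite card_ord => <-.
    apply: eq_card => s; rewrite [LHS]inE /= inE.
    apply/forallP/ffun_onP => rs i; first by rewrite inE.
    by have := rs i; rewrite inE.
  rewrite -sum_nat_const [leqRHS](bigID [in X]) /=.
  by apply: leq_trans (leq_addr _ _); apply: leq_sum => x /degX; apply: leq_expl.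
(* Each bad tuple inside [U s] is charged [#|T|], the trivial bound on [#|U s|]. A bad [h] lies
   inside [U s] only if all entries of [s] are in [CN h], hence for at most [n ^ t] samples. *)
have upper : \sum_s #|U s| <= #|T| ^ d * n ^ t * #|T| + #|T| ^ t * a.
  apply: (@leq_trans (\sum_(s : {ffun 'I_t -> T})
     (\sum_(h : {ffun 'I_d -> T} | #|CN h| < n) [forall j, h j \in U s] * #|T| + a))).
    apply: leq_sum => s _; have := noU s; rewrite negb_and -ltnNge.
    case/orP=> [/ltnW ltU|]; first by rewrite (leq_trans ltU) ?leq_addl.
    case/forallPn=> h; rewrite negb_imply -ltnNge => /andP[hU ltn].
    by rewrite (bigD1 h) //= hU mul1n -addnA (leq_trans (max_card _)) ?leq_addr.
  rewrite big_split /= sum_nat_const card_ffun card_ord leq_add2r exchange_big /=.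
  apply: (@leq_trans (\sum_(h : {ffun 'I_d -> T}) n ^ t * #|T|)); last first.
    by rewrite sum_nat_const card_ffun card_ord mulnA.
  rewrite [leqRHS](bigID (fun h => #|CN h| < n)) /=.
  apply: leq_trans (leq_addr _ _); apply: leq_sum => h ltn.
  rewrite -big_distrl /= leq_mul2r; apply/orP; right.
  apply: leq_trans (_ : #|CN h| ^ t <= _); last first.
    by apply: leq_expl; apply: ltnW.
  have := @card_ffun_on 'I_t T (mem (CN h)); rewrite card_ord => <-.
  rewrite -sum1_card big_mkcond /=.
  rewrite [leqRHS]big_mkcond; apply: leq_sum => s _.
  have [/forallP hU|//] := boolP [forall j, h j \in U s].
  suff -> : s \in ffun_on (mem (CN h)) by [].
  apply/ffun_onP => i; rewrite inE /=; apply/forallP => j.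
  by have := hU j; rewrite inE => /forallP.
by have := leq_ltn_trans (leq_trans lower upper) ltX; rewrite ltnn.
Qed.

(** Elements are chosen one at a time: at most [#|X| + m - 1] are forbidden at each choice, so [C i]
    still has a free one. *)
Lemma greedy_sdr (T : finType) (X : {set T}) (m : nat) (C : nat -> {set T}) :
  (forall i, i < m -> #|X| + m <= #|C i|) ->
  exists s : m.-tuple T, [/\ uniq s, forall x, x \in s -> x \notin X
    & forall i : 'I_m, tnth s i \in C i].
Proof.
elim: m => [|m IH] leC; first by exists [tuple]; split=> // -[].
have [|s [us sX sC]] := IH.
  by move=> i im; rewrite (leq_trans _ (leC i _)) ?leq_add2l ?ltnS // ltnW.
have /set0Pn[x] : C m :\: (X :|: [set x in s]) != set0.
  rewrite -card_gt0 cardsD subn_gt0 (leq_ltn_trans (subset_leq_card (subsetIr _ _))) //.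
  apply: leq_trans (leC m _) => //; rewrite addnS ltnS.
  rewrite (leq_trans (leq_card_setU _ _)) // leq_add2l cardsE.
  by rewrite (leq_trans (card_size _)) ?size_tuple.
rewrite !inE negb_or => /andP[/andP[xX xs] xC].
have sz : size (rcons s x) == m.+1 by rewrite size_rcons size_tuple.
exists (Tuple sz); split=> /=.
- by rewrite rcons_uniq xs.
- by move=> y; rewrite mem_rcons inE => /predU1P[->|/sX].
move=> i; rewrite (tnth_nth x) /= nth_rcons size_tuple.
have := ltn_ord i; rewrite ltnS leq_eqVlt => /predU1P[->|im].
  by rewrite ltnn eqxx.
by rewrite im; have := sC (Ordinal im); rewrite (tnth_nth x).
Qed.

(* The first [a] vertices contain [d] groups [p j] of size [q], and each of the
   other [m] vertices picks one neighbour in every group. *)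
Section Selection.
Variables (a m d q : nat) (p : 'I_d -> 'I_q -> 'I_a).

Fact card_cross (b : 'I_m) (j : 'I_d) (r : 'I_q) :
  #|[set lshift m (p j r); rshift a b]| == 2.
Proof. by rewrite cards2 eq_lrshift. Qed.

Definition cross (x : 'I_m * 'I_d * 'I_q) : edge (a + m) :=
  Sub [set lshift m (p x.1.2 x.2); rshift a x.1.1] (card_cross x.1.1 x.1.2 x.2).

Definition selection (g : {ffun 'I_m * 'I_d -> 'I_q}) : sgraph (a + m) :=
  [set cross (x, g x) | x in {: 'I_m * 'I_d}].

(** In a colour with many vertices of large degree, dependent random choice gives a set [U] whose
    [d]-tuples all have [a + m] common neighbours. The first [a] vertices go anywhere into [U]. Each
    other vertex has its [d] neighbours among them, so its image can be chosen greedily in a common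
    neighbourhood. *)
Lemma selection_arrows (D t N : nat) (g : {ffun 'I_m * 'I_d -> 'I_q}) :
  4 * D <= N ->
  N ^ d * (a + m) ^ t * N + N ^ t * a < 2 * D * D ^ t ->
  arrows (selection g) N.
Proof.
move=> leDN lt; apply/forallP => c.
pose adj k (x y : 'I_N) := [exists e : edge N, (val e == [set x; y]) && (c e == k)].
pose X k := [set x | D <= #|[set y | adj k x y]|].
(* A vertex with both colour degrees below [D] would force N - 1 <= 2D - 2, so [X true] and
   [X false] cover all [N >= 4 * D] vertices and one of them has at least [2 * D]. *)
have [k leX] : exists k, 2 * D <= #|X k|.
  apply/existsP; apply/contraT => /existsPn small.
  have : #|X true :|: X false| = N.
    rewrite -[RHS]card_ord -cardsT; congr #|pred_of_set _|.
    apply/setP => x; rewrite !inE; apply/contraT.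
    rewrite negb_or -!ltnNge => /andP[l1 l2].
    have : #|[set~ x]| <= #|[set y | adj true x y] :|: [set y | adj false x y]|.
      apply/subset_leq_card/subsetP => y; rewrite !inE => yx.
      have xy2 : #|[set x; y]| == 2 by rewrite cards2 (eq_sym x) yx.
      have adjc : adj (c (Sub [set x; y] xy2)) x y.
        by apply/existsP; exists (Sub [set x; y] xy2); rewrite !eqxx.
      by move: adjc; case: (c _) => ->; rewrite ?orbT.
    have := leq_of_leqif (leq_card_setU [set y | adj true x y] [set y | adj false x y]).
    have := cardsC1 x; rewrite card_ord; have := ltn_ord x; lia.
  have := small true; have := small false.
  have := leq_of_leqif (leq_card_setU (X true) (X false)); lia.
have adj_edge x y (xy2 : #|[set x; y]| == 2) :
    adj k x y -> [set x; y] \in edge_sets (color_class c k).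
  case/existsP=> e /andP[/eqP ve ce]; apply/imsetP; exists e => //.
  by rewrite inE.
have [||U [aU degU]] := @dependent_random_choice _ (adj k) (X k) D a (a + m) d t.
- by move=> x; rewrite inE.
- by rewrite card_ord (leq_trans lt) // leq_mul2r leX orbT.
pose phi (i : 'I_a) := enum_val (widen_ord aU i).
have phiI : injective phi.
  by move=> i j /enum_val_inj /(congr1 val) /= /val_inj.
pose nb (b : 'I_m) := [ffun j => phi (p j (g (b, j)))].
(* [greedy_sdr] takes a family indexed by [nat]; the value [set0] is only reached for indices from
   [m] on. *)
pose C i := if insub i is Some b then [set y | [forall j, adj k (nb b j) y]]
  else set0.
have [i im|s [us sX sC]] := @greedy_sdr _ (phi @: setT) m C.
  rewrite card_imset // cardsT card_ord /C insubT; apply: degU => j.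
  by rewrite ffunE enum_valP.
have sphi b i : tnth s b <> phi i.
  by move=> eq; have := sX _ (mem_tnth b s); rewrite eq imset_f ?inE.
pose f : {ffun 'I_(a + m) -> 'I_N} := [ffun i =>
  match split i with inl i => phi i | inr b => tnth s b end].
have fl i : f (lshift m i) = phi i.
  by rewrite ffunE; have := unsplitK (inl i : 'I_a + 'I_m) => /= ->.
have fr b : f (rshift a b) = tnth s b.
  by rewrite ffunE; have := unsplitK (inr b : 'I_a + 'I_m) => /= ->.
have fI : injective f.
  move=> x y; rewrite -(splitK x) -(splitK y).
  case: (split x) => i; case: (split y) => j /=; rewrite ?fl ?fr.
  - by move/phiI->.
  - by move/esym/sphi.
  - by move/sphi.
  - by move/(tuple_uniqP _ us)->.
apply/existsP; exists k; apply/existsP; exists f.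
apply/andP; split; first exact/injectiveP.
apply/forall_inP => _ /imsetP[_ /imsetP[[b j] _ ->] ->] /=.
have := @card_imset _ _ f [set lshift m (p j (g (b, j))); rshift a b] fI.
rewrite (eqP (card_cross _ _ _)) imsetU1 imset_set1 fl fr => /eqP.
move/adj_edge; apply; have := sC b; rewrite /C valK inE => /forallP/(_ j).
by rewrite ffunE.
Qed.

(** The choices are independent, so the selections inside [M] number the product of the [#|F x|].
    These sum to at most [#|M|], because injectivity of [p] makes the cross edges distinct, and 2k
    <= 2^k bounds each factor. *)
Lemma count_selections (M : sgraph (a + m)) :
  (forall j r j' r', p j r = p j' r' -> j = j' /\ r = r') ->
  #|[set g | selection g \subset M]| * 2 ^ (m * d) <= 2 ^ #|M|.
Proof.
move=> pI.
pose F (x : 'I_m * 'I_d) := [pred r | cross (x, r) \in M].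
have -> : #|[set g | selection g \subset M]| = #|family F|.
  apply: eq_card => g; rewrite inE; apply/subsetP/familyP => sM x.
    by apply: sM; apply: imset_f.
  by case/imsetP=> y _ ->; apply: sM.
have crossI : injective cross.
  move=> [[b j] r] [[b' j'] r'] /(congr1 val) /= eq.
  have : rshift a b \in [set lshift m (p j' r'); rshift a b'] by rewrite -eq set22.
  rewrite !inE eq_rlshift /= => /eqP/rshift_inj->.
  have : lshift m (p j r) \in [set lshift m (p j' r'); rshift a b'] by rewrite -eq set21.
  by rewrite !inE eq_lrshift orbF => /eqP/lshift_inj/pI[-> ->].
have sumF : \sum_x #|F x| <= #|M|.
  rewrite (eq_bigr (fun x => \sum_(r | cross (x, r) \in M) 1)) => [|x _]; last first.
    by rewrite sum1_card.
  rewrite pair_big_dep /= sum1_card -(card_imset _ crossI).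
  apply/subset_leq_card/subsetP => _ /imsetP[[x r] xrM ->].
  exact: xrM.
rewrite card_family foldrE big_map big_enum /=.
have -> : 2 ^ (m * d) = \prod_(x : 'I_m * 'I_d) 2.
  by rewrite prod_nat_const card_prod !card_ord.
rewrite -big_split /= (leq_trans _ (_ : 2 ^ (\sum_x #|F x|) <= _)) //; last first.
  by rewrite leq_exp2l.
rewrite expn_sum; apply: leq_prod => x _.
by case: #|F x| => // k; rewrite expnS mulnC leq_mul2l /= ltn_expl.
Qed.
End Selection.

(** * Maximal graphs with bounded Ramsey number *)

Lemma ramsey_le n (G : sgraph n) N : arrows G N -> ramsey G <= N.
Proof. by rewrite /ramsey; case: ex_minnP => r _ /[apply]. Qed.

Lemma arrows_ramsey n (G : sgraph n) : arrows G (ramsey G).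
Proof. by rewrite /ramsey; case: ex_minnP. Qed.

Definition ramsey_maximal n N : {set sgraph n} :=
  [set M | maxset (fun G : sgraph n => ramsey G <= N) M].

Lemma ramsey_maximal_saturated n N (M : sgraph n) :
  M \in ramsey_maximal n N -> ramsey_saturated M.
Proof.
rewrite inE => /maxsetP[MN maxM] e eM; apply: leq_ltn_trans MN _.
rewrite ltnNge; apply: contra eM => /maxM/(_ (subsetUr _ _)) <-.
exact: setU11.
Qed.

(** Every one of the [q ^ (m * d)] selections lies below a maximal graph [M], which contains at most
    2^(|M| - md) of them, and [arrows_card] bounds 2^|M|. *)
Lemma card_ramsey_maximal a m d q N (p : 'I_d -> 'I_q -> 'I_a) :
  (forall j r j' r', p j r = p j' r' -> j = j' /\ r = r') -> 0 < N ->
  (forall g : {ffun 'I_m * 'I_d -> 'I_q}, arrows (selection p g) N) ->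
  (2 * q) ^ (m * d) <= #|ramsey_maximal (a + m) N| * (2 * N ^ (a + m)).
Proof.
move=> pI N0 arr.
have cover : q ^ (m * d) <=
    \sum_(M in ramsey_maximal (a + m) N)
      #|[set g : {ffun 'I_m * 'I_d -> 'I_q} | selection p g \subset M]|.
  have <- : #|{ffun 'I_m * 'I_d -> 'I_q}| = q ^ (m * d).
    by rewrite card_ffun card_prod !card_ord.
  apply: leq_trans (leq_card_bigcup _ _).
  apply/subset_leq_card/subsetP => g _; apply/bigcupP.
  have [M maxM gM] := maxset_exists
    (P := fun G : sgraph (a + m) => ramsey G <= N) (ramsey_le (arr g)).
  by exists M; rewrite inE.
rewrite expnMn mulnC; apply: leq_trans (leq_mul cover (leqnn _)) _.
rewrite big_distrl /= -sum_nat_const; apply: leq_sum => M.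
rewrite inE => /maxsetp MN; apply: leq_trans (count_selections M pI) _.
apply: leq_trans (arrows_card (arrows_ramsey M)) _.
by rewrite leq_mul2l /= leq_expl.
Qed.

(** * Choice of parameters *)

Lemma selection_parameters h n d N D : 16 <= h -> n <= 2 ^ h ->
  d = 8 * h -> N = 2 ^ (5 * d) -> D = 2 ^ (5 * d - 2) ->
  N ^ d * n ^ (2 * d) * N + N ^ (2 * d) * (d * 32) < 2 * D * D ^ (2 * d).
Proof.
move=> h16 nh dE NE DE.
have dh : d * 32 <= 2 ^ (d - 3).
  have lt : h < 2 ^ h by apply: ltn_expl.
  have : 2 ^ 8 * 2 ^ h <= 2 ^ (d - 3).
    by rewrite -expnD leq_exp2l // dE; lia.
  rewrite dE; lia.
have nd : n ^ (2 * d) <= 2 ^ (h * (2 * d)) by rewrite (expnM 2 h) leq_expl.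
rewrite -!mulnA -expnS.
(* The right-hand side is 2^(x+1) with x = 10d^2 + d - 2, so it suffices to bound each summand by
   2^(x-1). The first has exponent at most 5d^2 + d^2/4 + 5d, since h = d/8; the second fits
   exactly, with 10d^2 + (d - 3). *)
set x := (5 * d - 2) * (2 * d).+1.
have -> : 2 * D ^ (2 * d).+1 = 2 ^ x.+1 by rewrite DE -expnM -expnS.
have A : N ^ d * (n ^ (2 * d) * N) <= 2 ^ x.-1.
  apply: (@leq_trans (2 ^ (5 * d * d) * (2 ^ (h * (2 * d)) * 2 ^ (5 * d)))).
    by rewrite NE (expnM 2 (5 * d)) leq_mul2l leq_mul2r nd !orbT.
  rewrite -!expnD leq_exp2l // /x dE; nia.
have B : N ^ (2 * d) * (d * 32) <= 2 ^ x.-1.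
  apply: (@leq_trans (2 ^ (5 * d * (2 * d)) * 2 ^ (d - 3))).
    by rewrite NE (expnM 2 (5 * d)) leq_mul2l dh orbT.
  rewrite -!expnD leq_exp2l // /x dE; nia.
have : 2 ^ x.-1 + 2 ^ x.-1 < 2 ^ x.+1.
  rewrite addnn -mul2n -expnS ltn_exp2l //; rewrite /x dE; nia.
by apply: leq_ltn_trans; apply: leq_add.
Qed.

Lemma ffact_leq_exp n k : n ^_ k <= n ^ k.
Proof.
rewrite ffact_prod -[k in n ^ k]card_ord -prod_nat_const.
by apply: leq_prod => i _; apply: leq_subr.
Qed.

Lemma many_saturated h n : 16 <= h -> 2048 * h <= n -> n <= 2 ^ h ->
  exists S : {set sgraph n},
    [/\ {in S, forall G, ramsey_saturated G},
        {in S &, forall G H, G != H -> ~ isomorphic G H}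
      & 2 ^ (h * n - 1) <= #|S|].
Proof.
move=> h16 hn nh; pose d := 8 * h.
have [m nE] : exists m, n = d * 32 + m.
  by exists (n - d * 32); rewrite subnKC // /d; lia.
(* The groups are the rows of a [d] by 32 array, flattened by [mxvec_index]. *)
pose N := 2 ^ (5 * d); pose p (j : 'I_d) (r : 'I_32) := mxvec_index j r.
have pI j r j' r' : p j r = p j' r' -> j = j' /\ r = r'.
  by move=> /cast_ord_inj/enum_rank_inj [-> ->].
have arr (g : {ffun 'I_m * 'I_d -> 'I_32}) : arrows (selection p g) N.
  apply: (@selection_arrows _ _ _ _ p (2 ^ (5 * d - 2)) (2 * d)).
    by rewrite -(expnD 2 2) leq_exp2l // /d; lia.
  by rewrite -nE; apply: (selection_parameters h16 nh).
have := card_ramsey_maximal pI (expn_gt0 2 (5 * d)) arr.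
rewrite -nE => count.
have [S [SM indep leS]] := nonisomorphic_family (ramsey_maximal n N).
exists S; split=> // [G GS|].
  by apply: (@ramsey_maximal_saturated _ N); apply: (subsetP SM).
have fact_n : n`! <= 2 ^ (h * n).
  apply: (@leq_trans (n ^ n)); last by rewrite (expnM 2 h) leq_expl.
  by rewrite -ffactnn ffact_leq_exp.
rewrite -(leq_pmul2r (_ : 0 < 2 ^ (h * n) * (2 * N ^ n))); last first.
  by rewrite !muln_gt0 !expn_gt0.
(* Since n >= 2048h, m = n - 256h >= 7n/8, so 64^(md) has binary exponent 48hm >= 42hn. Of this, N^n
   takes 40hn and n! at most hn, which leaves hn for [S], up to the factor 2. *)
apply: (@leq_trans ((2 * 32) ^ (m * d))).
  rewrite -[2 * 32]/(2 ^ 6) -expnM -expnM -expnS -!expnD leq_exp2l // /d.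
  move: nE hn h16; rewrite /d; nia.
apply: leq_trans count _; rewrite [leqRHS]mulnA leq_mul2r; apply/orP; right.
by apply: leq_trans leS _; rewrite leq_mul2l fact_n orbT.
Qed.

(** * The asymptotic statement *)

Import GRing.Theory Num.Theory.

Theorem theorem3p1 (R : realType) :
  exists c : R, (0 < c)%R /\
  exists n0 : nat, forall n : nat, n0 <= n ->
  exists S : {set sgraph n},
    [/\ {in S, forall G, ramsey_saturated G},
        {in S &, forall G H, G != H -> ~ isomorphic G H}
      & (2%:R `^ (c * n%:R ^+ 2) <= #|S|%:R :> R)%R].
Proof.
(* With h about n/2048 the exponent hn - 1 is about n^2/2048; halving the constant absorbs the
   rounding of h and the -1. *)
exists (4096%:R^-1)%R; split; first by rewrite invr_gt0 ltr0n.
exists (2048 * 16)%N => n n_large; pose h := n %/ 2048.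
have h16 : 16 <= h by rewrite /h; lia.
have hn : 2048 * h <= n by rewrite /h; lia.
have nh : n <= 2048 * h.+1 by rewrite /h; lia.
clearbody h.
(* Together with n <= 2^11 (h + 1) this gives [n <= 2 ^ h]. *)
have small : h.+1 <= 2 ^ (h - 11).
  rewrite -(subnKC h16); elim: (h - 16) => [//|k IH].
  rewrite (_ : 16 + k.+1 - 11 = (16 + k - 11).+1); last by lia.
  by rewrite expnS; move: (2 ^ _) IH => x; lia.
have n_le : n <= 2 ^ h.
  apply: leq_trans nh _; rewrite -[X in _ <= 2 ^ X](_ : 11 + (h - 11) = h); last lia.
  by rewrite expnD leq_mul2l.
have [S [satS isoS leS]] := many_saturated h16 hn n_le.
exists S; split=> //.
apply: (@Order.POrderTheory.le_trans _ _ (2%:R `^ (h * n - 1)%:R)%R).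
  apply: ler_powR; first by rewrite ler1n.
  rewrite mulrC ler_pdivrMr ?ltr0n // -natrX -natrM ler_nat.
  (* As h >= 16, n <= 2048(h + 1) <= (2048 + 128)h. *)
  have : n * n <= 2176 * h * n by rewrite leq_mul2r; lia.
  have : 16 * 1 <= h * n by rewrite leq_mul //; lia.
  rewrite -mulnn -mulnA mulnBl; lia.
by rewrite powR_mulrn ?ler0n // -natrX ler_nat.
Qed.
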